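(* Let $f:\mathbb{R}^d\to\mathbb{R}$ be differentiable with a global minimizer $w_*$. Suppose that $f$ satisfies $C_v$-one-point convexity ($C_v>0$) and $\hat\rho$-quasar convexity ($\hat\rho>0$) with respect to $w_*$. Then for any $\theta>1$, $f$ is also $\left(\rho=\frac{\hat\rho}{\theta},\ \mu=\frac{2C_v(\theta-1)}{\hat\rho}\right)$-strongly quasar convex.
   Context: Norms and inner products on $\mathbb{R}^d$ are Euclidean; all notions are with respect to the global minimizer $w_*$. $C_v$-one-point convexity: $\langle\nabla f(w),w-w_*\rangle\ge C_v\|w-w_*\|^2$ for all $w\in\mathbb{R}^d$. $\rho$-quasar convexity ($\rho>0$): $f(w_* )\ge f(w)+\frac1\rho\langle\nabla f(w),w_*-w\rangle$ for all $w\in\mathbb{R}^d$. $(\rho,\mu)$-strong quasar convexity ($\rho,\mu>0$): $f(w_* )\ge f(w)+\frac1\rho\langle\nabla f(w),w_*-w\rangle+\frac\mu2\|w_*-w\|^2$ for all $w\in\mathbb{R}^d$. *)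

(* Defs.v *)
From HB Require Import structures.
From mathcomp Require Import all_boot all_order all_algebra.
From mathcomp Require Import all_classical all_reals all_analysis.
Set Implicit Arguments.
Unset Strict Implicit.
Unset Printing Implicit Defensive.
Import Order.TTheory GRing.Theory Num.Theory.
Import numFieldNormedType.Exports.
Local Open Scope ring_scope.

Definition dotprod (R : realType) (d : nat) (u v : 'rV[R]_d) : R :=
  \sum_(i < d) u 0 i * v 0 i.

(* The library norm `|u| on row vectors is the sup norm: it yields the usual
   topology (hence the usual differentiability on R^d), but not the Euclidean
   length. *)
Definition enorm (R : realType) (d : nat) (u : 'rV[R]_d) : R :=
  Num.sqrt (dotprod u u).

Definition gradient (R : realType) (d : nat) (f : 'rV[R]_d -> R)
    (w : 'rV[R]_d) : 'rV[R]_d :=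
  \row_(i < d) 'D_(delta_mx 0 i) f w.

Lemma dotprod_gradient (R : realType) (d : nat) (f : 'rV[R]_d -> R)
    (w v : 'rV[R]_d) :
  differentiable f w -> dotprod (gradient f w) v = 'd f w v.
Proof.
move=> df; rewrite [in RHS](row_sum_delta v) linear_sum /=.
by apply: eq_bigr => i _; rewrite linearZ /= mxE deriveE // mulrC.
Qed.

Definition global_minimizer (R : realType) (d : nat) (f : 'rV[R]_d -> R)
    (wstar : 'rV[R]_d) : Prop :=
  forall w : 'rV[R]_d, f wstar <= f w.

Definition one_point_convex (R : realType) (d : nat) (f : 'rV[R]_d -> R)
    (wstar : 'rV[R]_d) (Cv : R) : Prop :=
  forall w : 'rV[R]_d,
    dotprod (gradient f w) (w - wstar) >= Cv * enorm (w - wstar) ^+ 2.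

Definition quasar_convex (R : realType) (d : nat) (f : 'rV[R]_d -> R)
    (wstar : 'rV[R]_d) (rho : R) : Prop :=
  0 < rho /\
  forall w : 'rV[R]_d,
    f wstar >= f w + 1 / rho * dotprod (gradient f w) (wstar - w).

Definition strongly_quasar_convex (R : realType) (d : nat)
    (f : 'rV[R]_d -> R) (wstar : 'rV[R]_d) (rho mu : R) : Prop :=
  [/\ 0 < rho, 0 < mu &
    forall w : 'rV[R]_d,
      f wstar >= f w + 1 / rho * dotprod (gradient f w) (wstar - w)
                 + mu / 2 * enorm (wstar - w) ^+ 2].

(* Main.v *)
Require Import Defs.
From HB Require Import structures.
From mathcomp Require Import all_boot all_order all_algebra.
From mathcomp Require Import all_classical all_reals all_analysis.
From mathcomp Require Import ring.
Import Order.TTheory GRing.Theory Num.Theory.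
Import numFieldNormedType.Exports.
Local Open Scope ring_scope.

(** Replacing [rhohat] by [rhohat / theta] multiplies the gradient term of the
    quasar convexity inequality by [theta], that is, adds [theta - 1] further
    copies of [(1 / rhohat) <grad f w, wstar - w>].  One-point convexity bounds
    each copy above by [- (Cv / rhohat) |wstar - w|^2], so the extra copies
    absorb the quadratic term [(theta - 1) * (Cv / rhohat) |wstar - w|^2],
    whose coefficient is exactly [mu / 2]. *)

Lemma dotprodNr (R : realType) (d : nat) (u v : 'rV[R]_d) :
  dotprod u (- v) = - dotprod u v.
Proof.
by rewrite /dotprod -sumrN; apply: eq_bigr => i _; rewrite mxE mulrN.
Qed.

Lemma enormN (R : realType) (d : nat) (u : 'rV[R]_d) : enorm (- u) = enorm u.
Proof.
by rewrite /enorm /dotprod; under eq_bigr do rewrite mxE mulrNN.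
Qed.

Theorem lemma6 (R : realType) (d : nat) (f : 'rV[R]_d -> R)
    (wstar : 'rV[R]_d) (Cv rhohat : R)
    (f_diff : forall w : 'rV[R]_d, differentiable f w)
    (wstar_min : global_minimizer f wstar)
    (Cv_gt0 : 0 < Cv) (rhohat_gt0 : 0 < rhohat)
    (f_opc : one_point_convex f wstar Cv)
    (f_qc : quasar_convex f wstar rhohat)
    (theta : R) (theta_gt1 : 1 < theta) :
  strongly_quasar_convex f wstar
    (rhohat / theta) (2 * Cv * (theta - 1) / rhohat).
Proof.
have theta1_gt0 : 0 < theta - 1 by rewrite subr_gt0.
split; first by rewrite divr_gt0 // (lt_trans ltr01).
  by rewrite divr_gt0 // !mulr_gt0.
move=> w; apply: le_trans (f_qc.2 w).
have := f_opc w; rewrite -(opprB wstar w) dotprodNr enormN.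
set p := dotprod _ _; set q := enorm _ ^+ 2 => opc.
have rhohat_neq0 : rhohat != 0 by rewrite gt_eqF.
have theta_neq0 : theta != 0 by rewrite gt_eqF // (lt_trans ltr01).
rewrite -subr_ge0.
(* What remains is [theta - 1] times the one-point convexity gap over [rhohat];
   the minus sign comes from [p] being taken along [wstar - w]. *)
have -> : f w + 1 / rhohat * p - (f w + 1 / (rhohat / theta) * p
            + 2 * Cv * (theta - 1) / rhohat / 2 * q)
          = (theta - 1) / rhohat * (- p - Cv * q).
  by field; apply/andP.
by rewrite mulr_ge0 ?subr_ge0 // divr_ge0 // ltW.
Qed.
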